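(* Let $\Bbbk$ be a field of characteristic zero, let $A_1,\dots,A_n$ be finite subsets of $\Bbbk$, let $\nu_i:A_i\to\mathbb{N}$ ($i=1,\dots,n$) be functions with positive integer values, and put $\mathbf{A}=A_1\times\cdots\times A_n$. Given arbitrary elements $t_{\mathbf{a}}^{\mathbf{k}}\in\Bbbk$ for $\mathbf{a}\in\mathbf{A}$ and $\mathbf{k}\in[\mathbf{0},\nu(\mathbf{a})-\mathbf{1}]$, there exists a unique polynomial $f\in V(\mathbf{A},\nu)$ such that $$\partial_{\mathbf{a}}^{\mathbf{m}}f=t_{\mathbf{a}}^{\mathbf{m}}\qquad\text{for all }\mathbf{a}\in\mathbf{A}\text{ and all }\mathbf{m}\in[\mathbf{0},\nu(\mathbf{a})-\mathbf{1}].$$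
   Context: For $\mathbf{a}=(a_1,\dots,a_n)\in\mathbf{A}$, $\nu(\mathbf{a}):=(\nu_1(a_1),\dots,\nu_n(a_n))\in\mathbb{N}^n$, where $\mathbb{N}$ is the set of positive integers. $[\mathbf{0},\nu(\mathbf{a})-\mathbf{1}]$ is the set of $\mathbf{k}=(k_1,\dots,k_n)$ with integers $0\le k_i\le \nu_i(a_i)-1$ for all $i$. $V(\mathbf{A},\nu)$ is the $\Bbbk$-vector space of all $f\in\Bbbk[x_1,\dots,x_n]$ with $\deg_i f<\sum_{a\in A_i}\nu_i(a)$ for $i=1,\dots,n$, where $\deg_i$ denotes the degree in the variable $x_i$ (the zero polynomial belongs to $V(\mathbf{A},\nu)$). For $\mathbf{k}\in\mathbb{N}_0^n$, $\partial_{\mathbf{a}}^{\mathbf{k}}f$ is the value at $\mathbf{x}=\mathbf{a}$ of the (formal) partial derivative $\frac{\partial^{k_1+\cdots+k_n}f}{\partial x_1^{k_1}\cdots\partial x_n^{k_n}}$. *)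

(* Defs.v *)
From HB Require Import structures.
From mathcomp Require Import all_boot all_order all_algebra.
From mathcomp Require Export finmap.
From mathcomp.multinomials Require Export mpoly.

Set Implicit Arguments.
Unset Strict Implicit.
Unset Printing Implicit Defensive.

Import GRing.Theory.
Local Open Scope ring_scope.

(* A multiplicity function nu_i : A_i -> N is represented by a function on all
   of K, of which only the values on A i are ever used. *)

Section HermiteSpace.
Variables (K : fieldType) (n : nat).
Implicit Types (A : 'I_n -> {fset K}) (nu : 'I_n -> K -> nat).
Implicit Types (a : {ffun 'I_n -> K}) (f : {mpoly K[n]}).

Definition cartesian A : pred {ffun 'I_n -> K} :=
  [pred a : {ffun 'I_n -> K} | [forall i, a i \in A i]].

Definition box nu a : pred 'X_{1..n} :=
  [pred k : 'X_{1..n} | [forall i, k i <= nu i (a i) - 1]%N].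

(* deg_in i 0 = 0, so V has to admit the zero polynomial separately: it matters
   when some A i is empty, as the sum below is then 0. *)
Definition deg_in (i : 'I_n) f : nat := (\max_(m <- msupp f) m i)%N.

Definition V A nu : pred {mpoly K[n]} :=
  [pred f : {mpoly K[n]} | (f == 0) || [forall i, deg_in i f < \sum_(x <- A i) nu i x]%N].

Definition pderiv_at a (k : 'X_{1..n}) f : K := (mderivm k f).@[a].

Lemma V_coef A nu f :
  reflect (forall m, m \in msupp f ->
             forall i, (m i < \sum_(x <- A i) nu i x)%N)
          (f \in V A nu).
Proof.
apply: (iffP orP) => [[/eqP->|/forallP Vf] m|Vf].
- by rewrite msupp0.
- by move=> fm i; apply: leq_ltn_trans (Vf i); apply: leq_bigmax_seq.
case: eqVneq => [|f0]; [by left | right].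
have fl := mlead_supp f0.
apply/forallP => i; rewrite /deg_in big_seq.
elim/big_ind: _ => [|x y|m /Vf//]; last by rewrite gtn_max => -> ->.
exact: leq_ltn_trans (Vf _ fl i).
Qed.

Lemma V_submod_closed A nu : submod_closed (V A nu).
Proof.
split=> [|c f g /V_coef Vf /V_coef Vg]; first by rewrite inE eqxx.
apply/V_coef => m /msuppD_le; rewrite mem_cat => /orP[/msuppZ_le|];
  [exact: Vf | exact: Vg].
Qed.

End HermiteSpace.

(* Main.v *)
Require Import Defs.
From mathcomp Require Import all_boot all_order all_algebra.

Local Open Scope ring_scope.

Import GRing.Theory.

Set Implicit Arguments.
Unset Strict Implicit.
Unset Printing Implicit Defensive.

(** In one variable, the matrix of the jet data [p |-> p^(k)(x)] (x in A,
    k < nu x) on the monomials of degree < d := sum nu is square, and it is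
    injective because a polynomial whose data vanish is divisible by
    [prod (X - x)^(nu x)], which has degree d.  In n variables the matrix of the
    data on the monomials is the Kronecker product of these n invertible
    matrices; its inverse is the Kronecker product of their inverses. *)

(** * Hermite conditions in one variable *)

Lemma dvdp_exp_XsubC_derivn (K : fieldType) (charK0 : [pchar K] =i pred0)
    (p : {poly K}) (x : K) (m : nat) :
  (forall k, (k < m)%N -> p^`(k).[x] = 0) -> ('X - x%:P) ^+ m %| p.
Proof.
move=> px0.
have -> : p = \sum_(i < size p) (p^`N(i).[x])%:P * ('X - x%:P) ^+ i.
  (* Taylor's formula over [{poly K}]: [p], with its coefficients read as constants, is evaluated at
     [x + ('X - x) = 'X], which gives back [p]. *)
  have := nderiv_taylor (map_poly polyC p) (mulrC x%:P ('X - x%:P)).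
  rewrite [x%:P + _]addrC subrK -/(_ \Po 'X) comp_polyXr size_map_polyC => {1}->.
  by apply: eq_bigr => i _; rewrite nderivn_map horner_map.
elim/big_rec: _ => [|i q _ dv_q]; first exact: dvdp0.
rewrite dvdp_addl //; have [lt_im | le_mi] := ltnP i m; last first.
  exact/dvdp_mull/dvdp_exp2l.
(* The Taylor coefficient times [i!] is the ordinary derivative at [x]; characteristic zero allows
   cancelling [i!]. *)
move: (px0 _ lt_im); rewrite nderivn_def hornerMn -mulr_natr => /eqP.
rewrite mulf_eq0 (pcharf0P K).1 // (gtn_eqF (fact_gt0 i)) orbF => /eqP->.
by rewrite mul0r dvdp0.
Qed.

(** Powers of linear factors at distinct nodes are coprime. *)
Lemma dvdp_prod_exp_XsubC (K : fieldType) (s : seq K) (nu : K -> nat)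
    (p : {poly K}) :
  uniq s -> {in s, forall x, ('X - x%:P) ^+ nu x %| p} ->
  \prod_(x <- s) ('X - x%:P) ^+ nu x %| p.
Proof.
elim: s => [|a s IHs] /=; first by rewrite big_nil dvd1p.
move=> /andP[sNa uniq_s] dv_p; rewrite big_cons Gauss_dvdp.
  rewrite dv_p ?mem_head // IHs // => x sx.
  by rewrite dv_p // inE sx orbT.
rewrite coprimep_expl // coprimep_sym coprimep_XsubC rootE horner_prod.
rewrite prodf_seq_neq0; apply/allP => b sb; rewrite horner_exp hornerXsubC.
by rewrite expf_neq0 // subr_eq0; apply: contraNneq sNa => ->.
Qed.

Definition jet_nodes (K : eqType) (s : seq K) (nu : K -> nat) : seq (K * nat) :=
  [seq (x, k) | x <- s, k <- iota 0 (nu x)].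

Lemma size_jet_nodes (K : eqType) (s : seq K) (nu : K -> nat) :
  size (jet_nodes s nu) = (\sum_(x <- s) nu x)%N.
Proof.
rewrite size_allpairs_dep sumnE big_map.
by apply: eq_bigr => x _; rewrite size_iota.
Qed.

Lemma mem_jet_nodes (K : eqType) (s : seq K) (nu : K -> nat) (x : K) (k : nat) :
  ((x, k) \in jet_nodes s nu) = (x \in s) && (k < nu x)%N.
Proof.
apply/allpairsPdep/andP => [[y [j [sy]]]|[sx ltk]].
  by rewrite mem_iota => /= ltj [-> ->].
by exists x, k; rewrite mem_iota.
Qed.

(** A confluent Vandermonde matrix: rows are monomials, columns are jet conditions. Indexing both by
    [size s] makes it square by construction. *)
Definition hermite_mx (K : fieldType) (s : seq (K * nat)) : 'M[K]_(size s) :=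
  \matrix_(j, l) ('X^j)^`((tnth (in_tuple s) l).2).[(tnth (in_tuple s) l).1].

Lemma hermite_mx_unit (K : fieldType) (charK0 : [pchar K] =i pred0)
    (s : seq K) (nu : K -> nat) :
  uniq s -> hermite_mx (jet_nodes s nu) \in unitmx.
Proof.
move=> uniq_s; rewrite -row_free_unit; apply: inj_row_free => v vH0.
(* A vector of the left kernel is read as the coefficients of a polynomial whose jet data all
   vanish. *)
pose p := rVpoly v; suff p0 : p = 0 by rewrite -[v]rVpolyK -/p p0 linear0.
have pE : p = \sum_j v 0 j *: 'X^j.
  rewrite /p /rVpoly poly_def; apply: eq_bigr => j _; by rewrite valK.
have p_jet x k : (x, k) \in jet_nodes s nu -> p^`(k).[x] = 0.
  move=> /seq_tnthP[l xkE]; move/rowP/(_ l): vH0; rewrite !mxE => <-.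
  rewrite pE linear_sum horner_sum; apply: eq_bigr => j _.
  by rewrite mxE -xkE linearZ hornerZ.
have dv_p : \prod_(z <- jet_nodes s nu) ('X - z.1%:P) %| p.
  rewrite big_allpairs_dep /= (eq_bigr (fun x => ('X - x%:P) ^+ nu x)).
    apply: dvdp_prod_exp_XsubC => // x sx.
    apply: dvdp_exp_XsubC_derivn => // k ltk.
    by apply: p_jet; rewrite mem_jet_nodes sx.
  by move=> x _; rewrite big_const_seq count_predT size_iota iter_mulr_1.
(* The product has degree d, the number of jet nodes, whereas [p] has degree less than d. *)
apply: contraTeq dv_p => p_neq0; apply/negP => /(dvdp_leq p_neq0).
by rewrite size_prod_XsubC leqNgt ltnS size_poly.
Qed.

(** * Kronecker products and derivatives of monomials *)

Lemma bigA_distr_fprod (R : comNzRingType) (I : finType) (T : I -> finType)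
    (F : forall i, T i -> R) :
  \prod_i \sum_(j : T i) F i j = \sum_(g : fprod T) \prod_i F i (g i).
Proof.
(* [bigA_distr_big_dep] wants a single index type, so the [T i] are embedded in their tagged sum;
   the default 0 of [untag] is never met on [tagged_with T i]. *)
transitivity (\prod_i \sum_(j in tagged_with T i) untag 0 (finfun (F i)) j).
  apply: eq_bigr => i _; rewrite -(big_tag (fun i => finfun (F i))).
  by apply: eq_bigr => j _; rewrite ffunE.
rewrite bigA_distr_big_dep -(big_fprod _ _ (fun i => finfun (F i))).
by apply: eq_bigr => g _; apply: eq_bigr => i _; rewrite ffunE.
Qed.

(** By distributivity the sum factors into the entries of the products [B i *m C i], that is, into
    Kronecker deltas. *)
Lemma kronecker_mul1 (R : comNzRingType) (I : finType) (d : I -> nat)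
    (B C : forall i, 'M[R]_(d i)) (g g' : fprod (fun i => 'I_(d i))) :
  (forall i, B i *m C i = 1%:M) ->
  \sum_(h : fprod (fun i => 'I_(d i)))
     (\prod_i B i (g i) (h i)) * (\prod_i C i (h i) (g' i)) = (g == g')%:R.
Proof.
move=> BC1; under eq_bigr do rewrite -big_split.
rewrite -(bigA_distr_fprod (fun i j => B i (g i) j * C i j (g' i))).
have E i : \sum_j B i (g i) j * C i j (g' i) = (g i == g' i)%:R.
  by have /matrixP/(_ (g i) (g' i)) := BC1 i; rewrite !mxE.
under eq_bigr do rewrite E.
case: (g =P g') => [->|neq_gg']; first by rewrite big1 // => i _; rewrite eqxx.
have /forallPn[i neq_i] : ~~ [forall i, g i == g' i].
  by apply/negP => /forallP eq_gg'; apply/neq_gg'/fprodP => i; apply/eqP.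
by rewrite (bigD1 i) //= (negPf neq_i) mul0r.
Qed.

Lemma pderiv_at_mpolyX (K : fieldType) (n : nat) (a : {ffun 'I_n -> K})
    (k m : 'X_{1..n}) :
  pderiv_at a k 'X_[m] = \prod_i ('X^(m i))^`(k i).[a i].
Proof.
rewrite /pderiv_at mderivmX mevalZ mevalX natr_prod -big_split.
apply: eq_bigr => i _; rewrite derivnXn hornerMn hornerXn mnmBE.
by rewrite -[RHS]mulr_natl.
Qed.

Lemma pderiv_at_sum (K : fieldType) (n : nat) (a : {ffun 'I_n -> K})
    (k : 'X_{1..n}) (I : finType) (c : I -> K) (F : I -> {mpoly K[n]}) :
  pderiv_at a k (\sum_i c i *: F i) = \sum_i c i * pderiv_at a k (F i).
Proof.
rewrite /pderiv_at !raddf_sum; apply: eq_bigr => i _.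
by rewrite /= mderivmZ mevalZ.
Qed.

(** * The grid of jet conditions and monomials *)

Section TensorGrid.

Variables (K : fieldType) (n : nat) (A : 'I_n -> {fset K}).
Variable nu : 'I_n -> K -> nat.

Let S i := jet_nodes (A i) (nu i).
(** One index type serves both sides of the linear system: an element selects a jet node in each
    variable, or an exponent in each variable. *)
Let G := fprod (fun i => 'I_(size (S i))).

Definition grid_node (g : G) : {ffun 'I_n -> K} :=
  [ffun i => (tnth (in_tuple (S i)) (g i)).1].

Definition grid_order (g : G) : 'X_{1..n} :=
  [multinom (tnth (in_tuple (S i)) (g i)).2 | i < n].

Definition grid_mnm (h : G) : 'X_{1..n} := [multinom (h i : nat) | i < n].

Lemma grid_mnm_inj : injective grid_mnm.
Proof.
move=> g h /mnmP gh; apply/fprodP => i; apply: val_inj.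
by move: (gh i); rewrite !mnmE.
Qed.

Lemma grid_mnm_onto (m : 'X_{1..n}) :
  (forall i, (m i < \sum_(x <- A i) nu i x)%N) -> exists h, grid_mnm h = m.
Proof.
move=> lt_m; have lt_mS i : (m i < size (S i))%N by rewrite size_jet_nodes.
exists [fprod i => Ordinal (lt_mS i)].
by apply/mnmP => i; rewrite mnmE fprodE.
Qed.

Lemma pderiv_at_grid (g h : G) :
  pderiv_at (grid_node g) (grid_order g) 'X_[grid_mnm h]
    = \prod_i hermite_mx (S i) (h i) (g i).
Proof.
rewrite pderiv_at_mpolyX; apply: eq_bigr => i _.
by rewrite !mnmE ffunE mxE.
Qed.

Lemma grid_cartesian_box (nu_gt0 : forall i x, x \in A i -> (0 < nu i x)%N)
    (g : G) :
  (grid_node g \in cartesian A) && (grid_order g \in box nu (grid_node g)).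
Proof.
have in_S i := mem_tnth (g i) (in_tuple (S i)).
apply/andP; split; apply/forallP => i; rewrite ?mnmE ffunE; move: (in_S i);
  case: (tnth _ _) => x k; rewrite mem_jet_nodes => /andP[Ax ltk] //=.
by rewrite subn1 -ltnS prednK // nu_gt0.
Qed.

Lemma grid_onto (nu_gt0 : forall i x, x \in A i -> (0 < nu i x)%N)
    (a : {ffun 'I_n -> K}) (m : 'X_{1..n}) :
  a \in cartesian A -> m \in box nu a ->
  exists g, grid_node g = a /\ grid_order g = m.
Proof.
move=> /forallP Aa /forallP box_m.
have S_am i : (a i, m i) \in S i.
  (* The subtraction in [box] is truncated; positivity of [nu] turns [m i <= nu i (a i) - 1] into a
     strict bound by [nu i (a i)]. *)
  rewrite mem_jet_nodes (Aa i) /= -(prednK (nu_gt0 _ _ (Aa i))) ltnS -subn1.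
  exact: box_m.
have idx i : {l | (a i, m i) = tnth (in_tuple (S i)) l}.
  exact/seq_tnthP/S_am.
exists [fprod i => sval (idx i)]; split; [apply/ffunP | apply/mnmP] => i;
  by rewrite ?mnmE ?ffunE fprodE -(svalP (idx i)).
Qed.

Lemma mcoeff_grid_sum (c : G -> K) (h : G) :
  (\sum_h' c h' *: 'X_[grid_mnm h'])@_(grid_mnm h) = c h.
Proof.
rewrite raddf_sum (bigD1 h) //= big1 => [|h' neq_h]; rewrite mcoeffZ mcoeffX.
  by rewrite eqxx mulr1 addr0.
by rewrite (inj_eq grid_mnm_inj) (negPf neq_h) mulr0.
Qed.

Lemma grid_sum_V (c : G -> K) :
  \sum_h c h *: 'X_[grid_mnm h] \in V A nu.
Proof.
elim/big_rec: _ => [|h f _ Vf]; first by rewrite inE eqxx.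
apply: (V_submod_closed A nu).2 Vf; apply/V_coef => m.
rewrite msuppX inE => /eqP-> i.
by rewrite mnmE -size_jet_nodes.
Qed.

(** The grid monomials are exactly those allowed in [V], so [f] is determined by its coefficients
    indexed by [G]. *)
Lemma V_grid_sum (f : {mpoly K[n]}) :
  f \in V A nu -> f = \sum_h f@_(grid_mnm h) *: 'X_[grid_mnm h].
Proof.
move=> Vf; set f' := \sum_h _; apply/mpolyP => m.
have [fm | f'm] := boolP ((m \in msupp f) || (m \in msupp f')).
  have [|h <-] := @grid_mnm_onto m; last by rewrite mcoeff_grid_sum.
  by case/orP: fm; apply/V_coef => //; apply: grid_sum_V.
by move: f'm; rewrite negb_or => /andP[? ?]; rewrite !memN_msupp_eq0.
Qed.

End TensorGrid.

Theorem theorem2p2 (K : fieldType) (charK0 : [pchar K] =i pred0) (n : nat)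
    (A : 'I_n -> {fset K}) (nu : 'I_n -> K -> nat)
    (nu_gt0 : forall (i : 'I_n) (x : K), x \in A i -> (0 < nu i x)%N)
    (t : {ffun 'I_n -> K} -> 'X_{1..n} -> K) :
  exists! f : {mpoly K[n]},
    f \in V A nu /\
    (forall a : {ffun 'I_n -> K}, a \in cartesian A ->
     forall m : 'X_{1..n}, m \in box nu a ->
       pderiv_at a m f = t a m).
Proof.
pose M i := hermite_mx (jet_nodes (A i) (nu i)).
pose B i := invmx (M i).
have uM i : M i \in unitmx by apply/hermite_mx_unit/fset_uniq.
have BM i : B i *m M i = 1%:M by apply: mulVmx.
have MB i : M i *m B i = 1%:M by apply: mulmxV.
pose G := fprod (fun i => 'I_(size (jet_nodes (A i) (nu i)))).
pose tg (g : G) := t (grid_node g) (grid_order g).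
(* The prescribed data multiplied by the Kronecker product of the inverses. *)
pose c (h : G) := \sum_g tg g * \prod_i B i (g i) (h i).
exists (\sum_h c h *: 'X_[grid_mnm h]); split=> [|f [Vf f_t]].
  split=> [|a Aa m box_m]; first exact: grid_sum_V.
  have [g [<- <-]] := grid_onto nu_gt0 Aa box_m.
  rewrite pderiv_at_sum; under eq_bigr do rewrite pderiv_at_grid mulr_suml.
  (* With the sum over [h] innermost, the Kronecker products of [B] and [M] cancel to the identity,
     and only the term of [g] survives. *)
  rewrite exchange_big (bigD1 g) //= [X in _ + X]big1 => [|g' neq_g].
    under eq_bigr do rewrite -mulrA; rewrite -mulr_sumr.
    by rewrite (kronecker_mul1 g g BM) eqxx mulr1 addr0.
  under eq_bigr do rewrite -mulrA; rewrite -mulr_sumr.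
  by rewrite (kronecker_mul1 g' g BM) (negPf neq_g) mulr0.
rewrite [RHS](V_grid_sum Vf); apply: eq_bigr => h _; congr (_ *: _).
(* Uniqueness: the data of any solution are its coefficients times the Kronecker product of the
   [M i], so applying the inverse recovers these coefficients. *)
have tgE g : tg g = \sum_h' f@_(grid_mnm h') * \prod_i M i (h' i) (g i).
  have /andP[Ag box_g] := grid_cartesian_box nu_gt0 g.
  rewrite /tg -f_t // [in LHS](V_grid_sum Vf) pderiv_at_sum.
  by under eq_bigr do rewrite pderiv_at_grid.
rewrite /c; under eq_bigr do rewrite tgE mulr_suml.
rewrite exchange_big (bigD1 h) //= [X in _ + X]big1 => [|h' neq_h].
  under eq_bigr do rewrite -mulrA; rewrite -mulr_sumr.
  by rewrite (kronecker_mul1 h h MB) eqxx mulr1 addr0.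
under eq_bigr do rewrite -mulrA; rewrite -mulr_sumr.
by rewrite (kronecker_mul1 h' h MB) (negPf neq_h) mulr0.
Qed.
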